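(* Let $\Phi:\mathbb{R}^3\to\mathbb{R}^3$, $\Phi(p)=(\Phi_1(p),\Phi_2(p),\Phi_3(p))$, be a smooth diffeomorphism of $\mathbb{R}^3$ with Jacobian matrix $J$, $J_{si}=\frac{\partial \Phi_s}{\partial x_i}$. Let $g$ be the Riemannian metric on $\mathbb{R}^3$ obtained by pulling back the Euclidean metric through $\Phi$, and let $\Gamma^m_{ij}$ be the Christoffel symbols of $g$ in the standard coordinates $(x_1,x_2,x_3)$ of $\mathbb{R}^3$. Then at every point of $\mathbb{R}^3$ and for all $i,j,m\in\{1,2,3\}$, $$\Gamma^m_{ij}=\sum_{s=1}^{3}\frac{\partial^2 \Phi_s}{\partial x_i\,\partial x_j}\,[J^{-1}]_{ms},$$ where $[J^{-1}]_{ms}$ denotes the entry in row $m$ and column $s$ of the inverse of $J$.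
   Context: The pullback metric $g$ has coefficients $g_{ij}=\sum_{k=1}^{3}\frac{\partial \Phi_k}{\partial x_i}\frac{\partial \Phi_k}{\partial x_j}$. The Christoffel symbols of a Riemannian metric $[g_{ij}]$ on $\mathbb{R}^3$ are $$\Gamma^m_{ij}=\frac12\sum_{k=1}^{3}\left(\frac{\partial g_{jk}}{\partial x_i}+\frac{\partial g_{ki}}{\partial x_j}-\frac{\partial g_{ij}}{\partial x_k}\right)g^{km},$$ where $[g^{ij}]$ is the inverse matrix of $[g_{ij}]$. *)

(* Defs.v *)
From HB Require Import structures.
From mathcomp Require Import all_boot all_order all_algebra.
From mathcomp Require Import all_classical all_reals all_analysis.

Set Implicit Arguments.
Unset Strict Implicit.
Unset Printing Implicit Defensive.

Import Order.TTheory GRing.Theory Num.Theory.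
Import numFieldNormedType.Exports.

Local Open Scope classical_set_scope.
Local Open Scope ring_scope.

Definition partial (R : realType) (n : nat) (i : 'I_n) (f : 'rV[R]_n -> R) :
    'rV[R]_n -> R :=
  fun p => 'D_(delta_mx 0 i) f p.

Definition component (R : realType) (n m : nat) (F : 'rV[R]_n -> 'rV[R]_m)
    (s : 'I_m) : 'rV[R]_n -> R :=
  fun p => F p 0 s.

(* ['D_v f] is total in the library, so the existence of each partial
   derivative is required separately. *)
Fixpoint Ck (R : realType) (n k : nat) (f : 'rV[R]_n -> R) : Prop :=
  continuous f /\
  if k is k'.+1 then
    forall i : 'I_n,
      (forall p, derivable f p (delta_mx 0 i)) /\ Ck k' (partial i f)
  else True.

Definition smooth (R : realType) (n m : nat) (F : 'rV[R]_n -> 'rV[R]_m) : Prop :=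
  forall (s : 'I_m) (k : nat), Ck k (component F s).

Definition smooth_diffeomorphism (R : realType) (n : nat)
    (F : 'rV[R]_n -> 'rV[R]_n) : Prop :=
  smooth F /\
  exists G : 'rV[R]_n -> 'rV[R]_n, [/\ smooth G, cancel F G & cancel G F].

(* Row s is the gradient of the s-th component. The library's ['J F p] acts on
   row vectors and is the transpose of this matrix. *)
Definition jacobian_matrix (R : realType) (n : nat) (F : 'rV[R]_n -> 'rV[R]_n)
    (p : 'rV[R]_n) : 'M[R]_n :=
  \matrix_(s, i) partial i (component F s) p.

Definition pullback_euclidean_metric (R : realType) (n : nat)
    (F : 'rV[R]_n -> 'rV[R]_n) (p : 'rV[R]_n) : 'M[R]_n :=
  \matrix_(i, j)
    \sum_(k < n) partial i (component F k) p * partial j (component F k) p.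

(* The coefficient with upper index m and lower indices i, j. *)
Definition christoffel (R : realType) (n : nat) (g : 'rV[R]_n -> 'M[R]_n)
    (m i j : 'I_n) (p : 'rV[R]_n) : R :=
  2^-1 * \sum_(k < n)
    (partial i (fun q => g q j k) p + partial j (fun q => g q k i) p
       - partial k (fun q => g q i j) p) * invmx (g p) k m.

(* Main.v *)
(* Write H_{ijs} for the second partials of Phi_s. Differentiating g = J^T J and
   using H_{ijs} = H_{jis}, the bracket in the Christoffel symbol collapses to
   2 sum_s H_{ijs} J_{sk}; then J g^{-1} = (J^T)^{-1} gives the formula, where J
   is invertible by the chain rule applied to the inverse diffeomorphism. Both
   the symmetry of second derivatives and the chain rule are deduced from
   one-variable mean values along coordinate lines. *)
Require Import Defs.
From HB Require Import structures.
From mathcomp Require Import all_boot all_order all_algebra.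
From mathcomp Require Import all_classical all_reals all_analysis.
From mathcomp Require Import ring.

Set Implicit Arguments.
Unset Strict Implicit.
Unset Printing Implicit Defensive.

Import Order.TTheory GRing.Theory Num.Theory.
Import numFieldNormedType.Exports.

Local Open Scope classical_set_scope.
Local Open Scope ring_scope.

(** * Limits, and mean values along a line *)

Lemma cvg0_le_norm (R : realFieldType) (T : Type) (F : set_system T)
    {FF : Filter F} (a b : T -> R) :
  (forall t, `|a t| <= `|b t|) -> b @ F --> 0 -> a @ F --> 0.
Proof.
move=> ab b0; apply: norm_cvg0.
apply: (@squeeze_cvgr _ _ _ _ (cst 0) (fun t => `|b t|)).
- by apply: nearW => t; rewrite normr_ge0 ab.
- exact: cvg_cst.
- by rewrite -(normr0 R); apply: cvg_norm.
Qed.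

(** A neighbourhood of a matrix contains a product of neighbourhoods of its entries, and finitely
    many eventual conditions hold simultaneously. *)
Lemma cvg_mx_coord (T : Type) (U : topologicalType) (m n : nat)
    (F : set_system T) (FF : Filter F) (f : T -> 'M[U]_(m, n))
    (M : 'M[U]_(m, n)) :
  (forall i j, (fun t => f t i j) @ F --> M i j) -> f @ F --> M.
Proof.
move=> cf A [P MP sPA].
have : \forall t \near F, forall i j, P i j (f t i j).
  apply: (filter_forall FF) => i; apply: (filter_forall FF) => j.
  exact/cf/MP.
by apply: filterS => t Pt; exact: sPA.
Qed.

Lemma is_derive_line (R : numFieldType) (V W : normedModType R) (f : V -> W)
    (p v : V) (t : R) :
  derivable f (t *: v + p) v ->
  is_derive t 1 (fun s : R => f (s *: v + p)) ('D_v f (t *: v + p)).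
Proof.
have E : (fun h => h^-1 *: (((fun s : R => f (s *: v + p)) \o shift t) (h *: 1)
            - f (t *: v + p))) =
         (fun h => h^-1 *: ((f \o shift (t *: v + p)) (h *: v) - f (t *: v + p))).
  by apply/funext => h /=; rewrite [h%:A]mulr1 scalerDl addrA.
by move=> df; apply: DeriveDef; rewrite ?/derivable ?/derive E.
Qed.

(** The one-variable mean value theorem on the segment between 0 and [t], for either sign of [t].
    The bound on [c] is all that later limits use. *)
Lemma mean_value_line (R : realType) (V : normedModType R) (f : V -> R) (v : V) :
  (forall p, derivable f p v) ->
  forall (p : V) (t : R), exists2 c : R,
    `|c| <= `|t| & f (t *: v + p) - f p = t * 'D_v f (c *: v + p).
Proof.
move=> df p t.
pose phi (s : R) := f (s *: v + p).
have dphi (s : R) : is_derive s 1 phi ('D_v f (s *: v + p)) by exact: is_derive_line.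
have cphi a b : {within `[a, b], continuous phi}.
  by apply: derivable_within_continuous => s _.
have phi0 : phi 0 = f p by rewrite /phi scale0r add0r.
have [t0|t0] := leP 0 t.
  have [c] := MVT_segment t0 (fun s _ => dphi s) (cphi _ _).
  rewrite in_itv /= => /andP[c0 ct] E; exists c.
    by rewrite !ger0_norm.
  by rewrite -phi0 [LHS]E subr0 mulrC.
have [c] := MVT_segment (ltW t0) (fun s _ => dphi s) (cphi _ _).
rewrite in_itv /= => /andP[tc c0] E; exists c.
  by rewrite !ler0_norm ?lerN2 // ltW.
by rewrite -phi0 -opprB [X in - X]E sub0r mulrN opprK mulrC.
Qed.

(** * Symmetry of second derivatives *)

(** Two mean values: first along [v] for the increment of [f] under translation by [t *: u], then
    along [u] for ['D_v f]. *)
Lemma second_difference (R : realType) (V : normedModType R) (f : V -> R)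
    (u v : V) :
  (forall p, derivable f p v) -> (forall p, derivable ('D_v f) p u) ->
  forall (p : V) (t : R), exists ab : R * R,
    [/\ `|ab.1| <= `|t|, `|ab.2| <= `|t| &
      f (t *: v + (t *: u + p)) - f (t *: u + p) - (f (t *: v + p) - f p)
      = t * t * 'D_u ('D_v f) (ab.2 *: u + (ab.1 *: v + p))].
Proof.
move=> dv du p t.
pose g (q : V) := f (t *: u + q) - f q.
have dg q : is_derive q v g ('D_v f (t *: u + q) - 'D_v f q).
  apply: is_deriveB; last exact: derivableP.
  have E : (fun h => h^-1 *: (((fun q => f (t *: u + q)) \o shift q) (h *: v)
              - f (t *: u + q))) =
      (fun h => h^-1 *: ((f \o shift (t *: u + q)) (h *: v) - f (t *: u + q))).
    by apply/funext => h /=; rewrite addrCA.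
  by apply: DeriveDef; rewrite ?/derivable ?/derive E //; exact: dv.
have [a at_ E1] := @mean_value_line _ _ g v (fun q => @ex_derive _ _ _ _ _ _ _ (dg q)) p t.
have [b bt E2] := @mean_value_line _ _ ('D_v f) u du (a *: v + p) t.
exists (a, b); split=> //=.
rewrite -mulrA -E2; move: E1; rewrite derive_val => <-.
by rewrite /g addrCA; ring.
Qed.

(* Both mixed derivatives are limits of the same second difference quotient
   along the diagonal, whose value is symmetric in [u] and [v]. *)
Lemma derive_comm (R : realType) (V : normedModType R) (f : V -> R)
    (u v p : V) :
  (forall q, derivable f q u) -> (forall q, derivable f q v) ->
  (forall q, derivable ('D_u f) q v) -> (forall q, derivable ('D_v f) q u) ->
  {for p, continuous ('D_u ('D_v f))} -> {for p, continuous ('D_v ('D_u f))} ->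
  'D_u ('D_v f) p = 'D_v ('D_u f) p.
Proof.
pose quot (w z : V) (t : R) :=
  (t * t)^-1 * (f (t *: z + (t *: w + p)) - f (t *: w + p)
                - (f (t *: z + p) - f p)).
have quot_cvg (w z : V) : (forall q, derivable f q z) ->
    (forall q, derivable ('D_z f) q w) -> {for p, continuous ('D_w ('D_z f))} ->
    quot w z @ 0^' --> 'D_w ('D_z f) p.
  move=> dz dwz cwz.
  (* Choice turns the intermediate parameters into functions of [t]; being bounded by [|t|], they
     tend to 0. *)
  have [ab /all_and3 [a_le b_le E]] := choice (second_difference dz dwz p).
  have id0 : (id : R -> R) @ 0^' --> (0 : R) by exact: cvg_within.
  have a0 : (fun t => (ab t).1) @ 0^' --> 0 by exact: cvg0_le_norm a_le id0.
  have b0 : (fun t => (ab t).2) @ 0^' --> 0 by exact: cvg0_le_norm b_le id0.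
  have ab0 : (fun t => (ab t).2 *: w + ((ab t).1 *: z + p)) @ 0^' --> p.
    rewrite -[X in _ --> X](_ : 0 *: w + (0 *: z + p) = p); last first.
      by rewrite !scale0r !add0r.
    apply: cvgD; first exact: cvgZr_tmp.
    by apply: cvgD; [exact: cvgZr_tmp|exact: cvg_cst].
  apply: cvg_trans (cvg_comp _ _ ab0 cwz); apply: near_eq_cvg.
  near=> t; rewrite /quot /= E mulKf // mulf_neq0 //; near: t; exact: nbhs_dnbhs_neq.
move=> du dv dvu duv cuv cvu.
apply: (@cvg_unique _ (@norm_hausdorff _ R) _ _ _ _ (quot_cvg u v dv duv cuv)).
have -> : quot u v = quot v u.
  by apply/funext => t; rewrite /quot addrCA; ring.
exact: quot_cvg.
Unshelve. all: by end_near. Qed.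

(** * Chain rule from continuous partial derivatives *)

(** Pass from [x] to [y] by changing one coordinate at a time: each change is a mean value along a
    coordinate line, and the increments telescope. The coordinatewise bound forces every [xi s] to
    tend to [x] when [y] does. *)
Lemma coordinate_mean_values (R : realType) (n : nat) (f : 'rV[R]_n -> R) :
  (forall i p, derivable f p (delta_mx 0 i)) ->
  forall x y : 'rV[R]_n, exists xi : 'I_n -> 'rV[R]_n,
    (forall s i, `|xi s 0 i - x 0 i| <= `|y 0 i - x 0 i|) /\
    f y - f x = \sum_s partial s f (xi s) * (y 0 s - x 0 s).
Proof.
move=> df x y.
pose mix (k : nat) : 'rV[R]_n := \row_i (if (i < k)%N then y 0 i else x 0 i).
have mixS (s : 'I_n) :
    mix s.+1 = (y 0 s - x 0 s) *: delta_mx 0 s + mix s.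
  apply/rowP => i; rewrite !mxE eqxx /= ltnS leq_eqVlt -(inj_eq val_inj) /=.
  have [/val_inj ->|_] := eqVneq (i : nat) s; last by rewrite mulr0 add0r.
  by rewrite ltnn mulr1 subrK.
have step (s : 'I_n) : exists z : 'rV[R]_n,
    (forall i, `|z 0 i - x 0 i| <= `|y 0 i - x 0 i|) /\
    f (mix s.+1) - f (mix s) = partial s f z * (y 0 s - x 0 s).
  have [c cle E] := mean_value_line (df s) (mix s) (y 0 s - x 0 s).
  exists (c *: delta_mx 0 s + mix s); split=> [i|]; last by rewrite mixS E mulrC.
  rewrite !mxE eqxx /= -(inj_eq val_inj) /=.
  have [/val_inj ->|_] := eqVneq (i : nat) s; first by rewrite ltnn mulr1 addrK.
  by rewrite mulr0 add0r; case: ifP => // _; rewrite subrr normr0.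
have [xi xiP] := choice step.
exists xi; split=> [s|]; first by have [] := xiP s.
have <- : mix n = y by apply/rowP => i; rewrite mxE ltn_ord.
have <- : mix 0 = x by apply/rowP => i; rewrite mxE.
have /= <- := telescope_sumr (f \o mix) (leq0n n); rewrite big_mkord.
apply: eq_bigr => s _; have [_ ->] := xiP s.
by rewrite !mxE ltn_ord.
Qed.

(** By coordinate mean values, the difference quotient of [f \o c] is a sum of partials at
    intermediate points times difference quotients of the coordinates of [c]; continuity of the
    partials gives the limit. *)
Lemma is_derive_comp_rV (R : realType) (V : normedModType R) (n : nat)
    (f : 'rV[R]_n -> R) (c : V -> 'rV[R]_n) (p v : V) :
  (forall i q, derivable f q (delta_mx 0 i)) ->
  (forall i, continuous (partial i f)) ->
  (forall s, derivable (fun q => c q 0 s) p v) ->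
  is_derive p v (f \o c)
    (\sum_s partial s f (c p) * 'D_v (fun q => c q 0 s) p).
Proof.
move=> df cf dc.
have [xi /all_and2 [xi_le fE]] := choice (coordinate_mean_values df (c p)).
pose line (h : R) : V := h *: v + p.
(* Derivability along [v] yields continuity of [c] on the line through [p], which suffices for the
   limit in [h]. *)
have c_cvg s : (fun h => c (line h) 0 s) @ 0^' --> c p 0 s.
  have : {for 0, continuous (fun h : R => c (line h) 0 s)}.
    apply/differentiable_continuous/derivable1_diffP.
    exact: (derivable1P _ _ _).1 (dc s).
  by move=> /continuous_withinNx; rewrite /line scale0r add0r.
have xi_cvg s : (fun h => xi (c (line h)) s) @ 0^' --> c p.
  apply: cvg_mx_coord => k i; rewrite ord1; apply: cvg_zero.
  apply: (@cvg0_le_norm _ _ _ _ _ (fun h => c (line h) 0 i - c p 0 i)) => [h|].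
    exact: xi_le.
  by rewrite -[X in _ --> X](subrr (c p 0 i)); apply: cvgB; [exact: c_cvg|exact: cvg_cst].
have lim : (fun h => h^-1 *: (((f \o c) \o shift p) (h *: v) - (f \o c) p))
    @ 0^' --> \sum_s partial s f (c p) * 'D_v (fun q => c q 0 s) p.
  rewrite (_ : (fun h => _) = (fun h => \sum_s partial s f (xi (c (line h)) s) *
     (h^-1 *: (c (line h) 0 s - c p 0 s)))).
    apply: cvg_big => [|s _]; first exact: add_continuous.
    by apply: cvgM; [exact: cvg_comp _ _ (xi_cvg s) (cf s _)|exact: dc].
  apply/funext => h; rewrite /= fE scaler_sumr; apply: eq_bigr => s _.
  by rewrite scalerAr.
by apply: DeriveDef; [apply/cvg_ex; eexists; exact: lim|exact: cvg_lim lim].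
Qed.

(** * Consequences for smooth maps and their Jacobians *)

Lemma Ck_derivable (R : realType) (n : nat) (f : 'rV[R]_n -> R) (k : nat) :
  Ck k.+1 f -> forall i p, derivable f p (delta_mx 0 i).
Proof. by move=> [_ fP] i; have [] := fP i. Qed.

Lemma Ck_partial (R : realType) (n : nat) (f : 'rV[R]_n -> R) (k : nat) :
  Ck k.+1 f -> forall i, Ck k (partial i f).
Proof. by move=> [_ fP] i; have [] := fP i. Qed.

Lemma Ck_continuous (R : realType) (n : nat) (f : 'rV[R]_n -> R) (k : nat) :
  Ck k f -> continuous f.
Proof. by case: k => [|k] []. Qed.

Lemma partial_comm (R : realType) (n : nat) (f : 'rV[R]_n -> R) :
  Ck 2 f -> forall i j p, partial i (partial j f) p = partial j (partial i f) p.
Proof.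
move=> f2 i j p.
have fi k := Ck_partial f2 k.
apply: (@derive_comm R _ f (delta_mx 0 i) (delta_mx 0 j) p).
- exact: Ck_derivable f2 i.
- exact: Ck_derivable f2 j.
- exact: Ck_derivable (fi i) j.
- exact: Ck_derivable (fi j) i.
- exact: Ck_continuous (Ck_partial (fi j) i) p.
- exact: Ck_continuous (Ck_partial (fi i) j) p.
Qed.

(** Entry [(s, i)] of the product is the chain rule for the [i]-th partial of [component G s \o F],
    which is the [s]-th coordinate function. *)
Lemma jacobian_matrix_cancel (R : realType) (n : nat)
    (F G : 'rV[R]_n -> 'rV[R]_n) (p : 'rV[R]_n) :
  smooth F -> smooth G -> cancel F G ->
  jacobian_matrix G (F p) *m jacobian_matrix F p = 1%:M.
Proof.
move=> sF sG FK; apply/matrixP => s i; rewrite !mxE.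
have dF t : derivable (fun q => F q 0 t) p (delta_mx 0 i).
  exact: Ck_derivable (sF t 1) i p.
have cG t : continuous (partial t (component G s)).
  exact: Ck_continuous (Ck_partial (sG s 1) t).
have [_ chain] := is_derive_comp_rV (Ck_derivable (sG s 1)) cG dF.
under eq_bigr do rewrite !mxE.
rewrite -[LHS]chain.
have -> : component G s \o F = fun q => q 0 s.
  by apply/funext => q; rewrite /component /= FK.
have /matrixP /(_ 0 s) := derive_mx (@derivable_id _ _ p (delta_mx 0 i)).
by rewrite derive_id !mxE eqxx /= eq_sym => <-.
Qed.

(** * The pullback metric and its Christoffel symbols *)

Lemma partial_metric (R : realType) (n : nat) (F : 'rV[R]_n -> 'rV[R]_n) :
  smooth F -> forall (l i j : 'I_n) (p : 'rV[R]_n),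
  partial l (fun q => pullback_euclidean_metric F q i j) p =
  \sum_s (partial l (partial i (component F s)) p * jacobian_matrix F p s j
        + partial l (partial j (component F s)) p * jacobian_matrix F p s i).
Proof.
move=> sF l i j p.
have dF s k : derivable (partial k (component F s)) p (delta_mx 0 l).
  exact: Ck_derivable (Ck_partial (sF s 2) k) l p.
have -> : (fun q => pullback_euclidean_metric F q i j) =
    \sum_s partial i (component F s) * partial j (component F s).
  by apply/funext => q; rewrite mxE fct_sumE.
rewrite {1}/partial derive_sum => [|s]; last exact: derivableM.
apply: eq_bigr => s _; rewrite deriveM // !mxE.
by rewrite addrC; congr (_ + _); exact: mulrC.
Qed.

Lemma pullback_euclidean_metricE (R : realType) (n : nat)
    (F : 'rV[R]_n -> 'rV[R]_n) (p : 'rV[R]_n) :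
  pullback_euclidean_metric F p
  = (jacobian_matrix F p)^T *m jacobian_matrix F p.
Proof.
by apply/matrixP => i j; rewrite !mxE; apply: eq_bigr => k _; rewrite !mxE.
Qed.

Lemma christoffel_pullback (R : realType) (n : nat) (F : 'rV[R]_n -> 'rV[R]_n) :
  smooth_diffeomorphism F -> forall (p : 'rV[R]_n) (i j m : 'I_n),
  christoffel (pullback_euclidean_metric F) m i j p =
  \sum_(s < n) partial i (partial j (component F s)) p
               * invmx (jacobian_matrix F p) m s.
Proof.
move=> [sF [G [sG FK _]]] p i j m.
have [_ Ju] := mulmx1_unit (jacobian_matrix_cancel p sF sG FK).
set J := jacobian_matrix F p in Ju *.
(* The second derivatives are kept abstract so that rewriting with their
   symmetry does not unfold the limits defining them. *)
have [H HE] : exists H : 'I_n -> 'I_n -> 'I_n -> R,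
    forall a b s, H a b s = partial a (partial b (component F s)) p.
  by exists (fun a b s => partial a (partial b (component F s)) p).
have Hsym a b s : H a b s = H b a s by rewrite !HE (partial_comm (sF s 2)).
have dg l a b : partial l (fun q => pullback_euclidean_metric F q a b) p
    = \sum_s (H l a s * J s b + H l b s * J s a).
  by rewrite (partial_metric sF); apply: eq_bigr => s _; rewrite !HE.
(* By symmetry of [H], the terms carrying [J s i] and [J s j] cancel, and the two carrying [J s k]
   coincide. *)
have bracket k : partial i (fun q => pullback_euclidean_metric F q j k) p
    + partial j (fun q => pullback_euclidean_metric F q k i) p
    - partial k (fun q => pullback_euclidean_metric F q i j) p
    = 2 * \sum_s H i j s * J s k.
  rewrite !dg -big_split -sumrB mulr_sumr /=; apply: eq_bigr => s _.
  by rewrite (Hsym j i) (Hsym k i) (Hsym k j); ring.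
rewrite /christoffel; under eq_bigr do rewrite bracket -mulrA.
rewrite -mulr_sumr mulKf ?pnatr_eq0 //.
under eq_bigr do rewrite mulr_suml.
(* With the sum over the metric index [k] innermost, [J] is contracted with the inverse metric. *)
rewrite exchange_big; apply: eq_bigr => s _ /=; rewrite -HE.
under eq_bigr do rewrite -mulrA.
rewrite -mulr_sumr; congr (_ * _).
have -> : invmx J m s = (J *m invmx (pullback_euclidean_metric F p)) s m.
  rewrite pullback_euclidean_metricE -/J.
  have JTu : J^T \in unitmx by rewrite unitmx_tr.
  have gu : J^T *m J \in unitmx by rewrite unitmx_mul JTu.
  (* Writing [J] as [invmx J^T *m (J^T *m J)] cancels the inverse metric; the remaining transpose
     swaps [s] and [m]. *)
  rewrite -[X in X *m _](mulKmx JTu) mulmxK //.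
  by rewrite -trmx_inv mxE.
by rewrite mxE.
Qed.

Unset Implicit Arguments.

Theorem theorem5p1 (R : realType) (Phi : 'rV[R]_3 -> 'rV[R]_3)
    (Phi_diffeo : smooth_diffeomorphism Phi) (p : 'rV[R]_3) (i j m : 'I_3) :
  christoffel (pullback_euclidean_metric Phi) m i j p =
  \sum_(s < 3) partial i (partial j (component Phi s)) p
               * invmx (jacobian_matrix Phi p) m s.
Proof. exact: christoffel_pullback. Qed.
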